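(* Let $(\mathcal{L},\circ_\lambda)$ be a commutative associative conformal superalgebra and $(\mathcal{L},[\cdot_\lambda\cdot])$ be a Lie conformal superalgebra (on the same $\mathbb{Z}_2$-graded $\mathbb{C}[\partial]$-module $\mathcal{L}$). Then $(\mathcal{L},\circ_\lambda,[\cdot_\lambda\cdot])$ is both a Poisson conformal superalgebra and a transposed Poisson conformal superalgebra if and only if $$a\circ_\lambda[b_\mu c]=[b_{\mu-\lambda}a]\circ_\mu c=[(a\circ_\lambda b)_{\lambda+\mu}c]=0,\qquad\forall\, a,b,c\in\mathcal{L}.$$
   Context: All vector spaces and linear maps are over $\mathbb{C}$. A $\mathbb{Z}_2$-graded $\mathbb{C}[\partial]$-module is a $\mathbb{C}[\partial]$-module $A=A_{\bar0}\oplus A_{\bar1}$ with $\partial A_i\subseteq A_i$; $|a|$ denotes the parity of a homogeneous element $a$. Whenever $|a|$ occurs, $a$ is assumed homogeneous, and the formula is extended by linearity. $A[\lambda]$ denotes polynomials in $\lambda$ with coefficients in $A$. A conformal superalgebra $(A,\circ_\lambda)$ is a $\mathbb{Z}_2$-graded $\mathbb{C}[\partial]$-module $A$ with a $\mathbb{C}$-bilinear map $A\otimes A\to A[\lambda]$, $a\otimes b\mapsto a\circ_\lambda b$, with $A_i\circ_\lambda A_j\subseteq A_{i+j}[\lambda]$, satisfying sesquilinearity: $(\partial a)\circ_\lambda b=-\lambda\, a\circ_\lambda b$, $a\circ_\lambda(\partial b)=(\partial+\lambda)(a\circ_\lambda b)$. Substitution convention: if $a\circ_\lambda b=\sum_n\lambda^n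 c_n$, then $a\circ_{-\partial-\lambda}b=\sum_n(-\partial-\lambda)^nc_n$ with $\partial$ acting on the coefficients $c_n$, and similarly for brackets. It is commutative if $a\circ_\lambda b=(-1)^{|a||b|}b\circ_{-\partial-\lambda}a$, and associative if $a\circ_\lambda(b\circ_\mu c)=(a\circ_\lambda b)\circ_{\lambda+\mu}c$, for all $a,b,c$. A Lie conformal superalgebra $(A,[\cdot_\lambda\cdot])$ is a $\mathbb{Z}_2$-graded $\mathbb{C}[\partial]$-module with a $\mathbb{C}$-bilinear map $a\otimes b\mapsto[a_\lambda b]\in A[\lambda]$, $[{A_i}_\lambda A_j]\subseteq A_{i+j}[\lambda]$, such that $[(\partial a)_\lambda b]=-\lambda[a_\lambda b]$, $[a_\lambda(\partial b)]=(\partial+\lambda)[a_\lambda b]$, $[a_\lambda b]=-(-1)^{|a||b|}[b_{-\lambda-\partial}a]$, and $[a_\lambda[b_\mu c]]=[[a_\lambda b]_{\lambda+\mu}c]+(-1)^{|a||b|}[b_\mu[a_\lambda c]]$. Let $(\mathcal{L},\circ_\lambda)$ be a commutative associative conformal superalgebra and $(\mathcal{L},[\cdot_\lambda\cdot])$ a Lie conformal superalgebra. The triple $(\mathcal{L},\circ_\lambda,[\cdot_\lambda\cdot])$ is a Poisson conformal superalgebra if $[a_\lambda(b\circ_\mu c)]=[a_\lambda b]\circ_{\lambda+\mu}c+(-1)^{|a||b|}b\circ_\mu[a_\lambda c]$ for all $a,b,c\in\mathcal{L}$; it is a transposed Poisson conformal superalgebra if $2(a\circ_\lambda[b_\mu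 c])=[(a\circ_\lambda b)_{\lambda+\mu}c]+(-1)^{|a||b|}[b_\mu(a\circ_\lambda c)]$ for all $a,b,c\in\mathcal{L}$. *)

(* Defs.v *)
From mathcomp Require Import all_boot all_order all_algebra.
From mathcomp Require Import finmap monalg.

Set Implicit Arguments.
Unset Strict Implicit.
Unset Printing Implicit Defensive.

Import GRing.Theory.
Local Open Scope ring_scope.

Record gradedDModule (K : fieldType) := GradedDModule {
  gsort :> lmodType K;
  partial : {linear gsort -> gsort};
  gpart : 'Z_2 -> {pred gsort};
  gpart_submod : forall i, submod_closed (gpart i);
  gpart_sum : forall x, exists x0 x1,
    [/\ x0 \in gpart 0, x1 \in gpart 1 & x = x0 + x1];
  gpart_direct : forall x, x \in gpart 0 -> x \in gpart 1 -> x = 0;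
  partial_gpart : forall i x, x \in gpart i -> partial x \in gpart i
}.

Arguments partial {K} g : rename.
Arguments gpart {K} g i _ : rename.

(* Polynomials with coefficients in V are the finitely supported functions
   {malg V[G]} from an additive monoid G of exponents: G = nat in one variable
   lambda, G = nat * nat in two variables lambda, mu. *)

Section Polynomials.
Variables (V : zmodType) (G : nmodType).

Definition mulmon (e : G) (f : {malg V[G]}) : {malg V[G]} :=
  \sum_(m <- msupp f) << f@_m *g e + m >>.

Definition mapcoef (d : V -> V) (f : {malg V[G]}) : {malg V[G]} :=
  \sum_(m <- msupp f) << d f@_m *g m >>.

Definition cstpol (v : V) : {malg V[G]} := << v *g 0 >>.

(* For f = \sum_n lambda^n c_n, this is \sum_n T^n (F c_n): the substitution
   lambda := T, with the map F applied to the coefficients. *)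
Definition subst (T : {malg V[G]} -> {malg V[G]}) (F : V -> {malg V[G]})
    (f : {malg V[nat]}) : {malg V[G]} :=
  \sum_(n <- msupp f) iter n T (F f@_n).

End Polynomials.

Section ConformalSuperalgebras.
Variables (K : fieldType) (L : gradedDModule K).

Definition lproduct := L -> L -> {malg L[nat]}.

Implicit Types (p q : lproduct).

(* The operators lambda and partial on L[lambda]. *)
Definition lam1 : {malg L[nat]} -> {malg L[nat]} := mulmon 1%N.
Definition del1 : {malg L[nat]} -> {malg L[nat]} := mapcoef (partial L).

(* The operators lambda and mu on L[lambda, mu]. *)
Definition lam : {malg L[(nat * nat)%type]} -> {malg L[(nat * nat)%type]} :=
  mulmon (1%N, 0%N).
Definition mu : {malg L[(nat * nat)%type]} -> {malg L[(nat * nat)%type]} :=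
  mulmon (0%N, 1%N).

(* a p_T (b q_S c) and (a p_T b) q_S c in L[lambda, mu], where T and S are
   linear forms in lambda and mu; the outer product extends linearly over
   C[lambda, mu] to the coefficients of the inner one. *)
Definition nestr p T q S (a b c : L) : {malg L[(nat * nat)%type]} :=
  subst S (fun x => subst T (@cstpol _ _) (p a x)) (q b c).
Definition nestl p T q S (a b c : L) : {malg L[(nat * nat)%type]} :=
  subst T (fun x => subst S (@cstpol _ _) (q x c)) (p a b).

(* b p_{-partial-lambda} a *)
Definition flip p (a b : L) : {malg L[nat]} :=
  subst (fun f => - del1 f - lam1 f) (@cstpol _ _) (p b a).

(* The sign (-1)^{|a||b|} is an integer, which acts on polynomials by *~. *)
Definition ksign (i j : 'Z_2) : int := (-1) ^+ (i * j)%R.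

Definition conformal_product p :=
  [/\ forall b n, linear (fun a => (p a b)@_n),
      forall a n, linear (fun b => (p a b)@_n),
      forall i j a b n, a \in gpart L i -> b \in gpart L j ->
        (p a b)@_n \in gpart L (i + j),
      forall a b, p (partial L a) b = - lam1 (p a b)
    & forall a b, p a (partial L b) = del1 (p a b) + lam1 (p a b)].

Definition conformal_commutative p :=
  forall i j a b, a \in gpart L i -> b \in gpart L j ->
    p a b = flip p a b *~ ksign i j.

Definition conformal_associative p :=
  forall a b c, nestr p lam p mu a b c = nestl p lam p (lam \+ mu) a b c.

Definition comm_assoc_conformal_superalgebra p :=
  [/\ conformal_product p, conformal_commutative p
    & conformal_associative p].

Definition conformal_skew_symmetric p :=
  forall i j a b, a \in gpart L i -> b \in gpart L j ->
    p a b = - (flip p a b *~ ksign i j).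

Definition conformal_jacobi p :=
  forall i j a b c, a \in gpart L i -> b \in gpart L j ->
    nestr p lam p mu a b c =
      nestl p lam p (lam \+ mu) a b c + nestr p mu p lam b a c *~ ksign i j.

Definition lie_conformal_superalgebra p :=
  [/\ conformal_product p, conformal_skew_symmetric p & conformal_jacobi p].

Definition conformal_leibniz circ br :=
  forall i j a b c, a \in gpart L i -> b \in gpart L j ->
    nestr br lam circ mu a b c =
      nestl br lam circ (lam \+ mu) a b c
      + nestr circ mu br lam b a c *~ ksign i j.

Definition conformal_transposed_leibniz circ br :=
  forall i j a b c, a \in gpart L i -> b \in gpart L j ->
    nestr circ lam br mu a b c *+ 2 =
      nestl circ lam br (lam \+ mu) a b c
      + nestr br mu circ lam b a c *~ ksign i j.

Definition poisson_conformal_superalgebra circ br :=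
  [/\ comm_assoc_conformal_superalgebra circ, lie_conformal_superalgebra br
    & conformal_leibniz circ br].

Definition transposed_poisson_conformal_superalgebra circ br :=
  [/\ comm_assoc_conformal_superalgebra circ, lie_conformal_superalgebra br
    & conformal_transposed_leibniz circ br].

End ConformalSuperalgebras.

Arguments lam {K L} f.
Arguments mu {K L} f.

(* Main.v *)
(* Write T(a, b, c) = a o [b c] and attach to the three slots operators A, B, C
   with A + B + C + partial = 0. Commutativity and skew symmetry move every
   nested product to right-nested form by permuting slots together with their
   operators, so that conformal algebra reduces to the ordinary argument: the
   two Leibniz rules together give T(a, b, c) = T(b, a, c) up to sign, while T is
   antisymmetric in b and c. A function of three arguments that is symmetric in
   the first two and antisymmetric in the last two satisfies T = - T, so T = 0
   and then [a (b o c)] = 0 by the Leibniz rule. *)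
Require Import Defs.
From HB Require Import structures.
From mathcomp Require Import all_boot all_order all_algebra.
From mathcomp Require Import finmap monalg reals complex.
Import GRing.Theory.
Local Open Scope ring_scope.

Set Implicit Arguments.
Unset Strict Implicit.
Unset Printing Implicit Defensive.

(** * Additive maps on finitely supported functions *)

Section MonomialExtension.
Variables (V W : zmodType) (K : choiceType).

(** Monomials generate the additive group of polynomials, so the operator identities below reduce to
    one coefficient and one exponent. *)
Lemma zmod_morphism_eq_monomials (f g : {malg V[K]} -> W) :
    zmod_morphism f -> zmod_morphism g ->
    (forall c k, f << c *g k >> = g << c *g k >>) ->
  f =1 g.
Proof.
move=> fB gB fg x.
pose f' : {additive _ -> _} := HB.pack f (GRing.isZmodMorphism.Build _ _ f fB).
pose g' : {additive _ -> _} := HB.pack g (GRing.isZmodMorphism.Build _ _ g gB).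
rewrite [x]monalgE -[f]/(f' : _ -> _) -[g]/(g' : _ -> _) !raddf_sum /=.
by apply: eq_bigr => k _; apply: fg.
Qed.

Variable (h : K -> V -> W).
Hypothesis hB : forall k, zmod_morphism (h k).

Let h' k : {additive V -> W} :=
  HB.pack (h k) (GRing.isZmodMorphism.Build _ _ (h k) (hB k)).

(** Terms outside the support vanish because [h k 0 = 0]. This lets sums for [f], [g] and [f - g],
    whose supports differ, be compared over one common set. *)
Lemma sum_msuppw (d : {fset K}) (f : {malg V[K]}) :
    (msupp f `<=` d)%fset ->
  \sum_(k <- msupp f) h k f@_k = \sum_(k <- d) h k f@_k.
Proof.
move=> le; apply/big_fset_incl => // k _ /mcoeff_outdom ->.
exact: (raddf0 (h' k)).
Qed.

Lemma sum_msupp_zmod_morphism :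
  zmod_morphism (fun f : {malg V[K]} => \sum_(k <- msupp f) h k f@_k).
Proof.
move=> f g; pose d := (msupp f `|` msupp g)%fset.
rewrite (@sum_msuppw d (f - g)) ?msuppB_le //.
rewrite (@sum_msuppw d f) ?fsubsetUl // (@sum_msuppw d g) ?fsubsetUr //.
by rewrite -sumrB; apply: eq_bigr => k _; rewrite mcoeffB hB.
Qed.

Lemma sum_msuppU c k :
  \sum_(m <- msupp << c *g k >>) h m << c *g k >>@_m = h k c.
Proof.
rewrite (@sum_msuppw [fset k]%fset) ?msuppU_le //.
by rewrite big_seq_fset1 mcoeffUU.
Qed.

End MonomialExtension.

Section Iter.
Variables (W : zmodType) (T : {additive W -> W}) (n : nat).

Lemma iter_zmod_morphism : zmod_morphism (iter n T).
Proof. by move=> x y; elim: n => //= m ->; rewrite raddfB. Qed.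
HB.instance Definition _ :=
  GRing.isZmodMorphism.Build W W (iter n T) iter_zmod_morphism.

End Iter.

(** * Multiplication by monomials and coefficientwise maps *)

Section Operators.
Variables (V : zmodType) (G : nmodType).

Lemma mulmon_zmod_morphism (e : G) : zmod_morphism (@mulmon V G e).
Proof.
by apply: (@sum_msupp_zmod_morphism _ _ _ (fun m c => << c *g e + m >>)) => m;
  apply: raddfB.
Qed.
HB.instance Definition _ (e : G) := GRing.isZmodMorphism.Build
  {malg V[G]} {malg V[G]} (@mulmon V G e) (mulmon_zmod_morphism e).

Lemma mulmonU (e m : G) (c : V) : mulmon e << c *g m >> = << c *g e + m >>.
Proof.
by apply: (@sum_msuppU _ _ _ (fun m c => << c *g e + m >>)) => k; apply: raddfB.
Qed.

Variable d : {additive V -> V}.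

Let mapcoefB (m : G) : zmod_morphism (fun c => << d c *g m >> : {malg V[G]}).
Proof. by move=> x y; rewrite !raddfB. Qed.

Lemma mapcoef_zmod_morphism : zmod_morphism (@mapcoef V G d).
Proof. exact: sum_msupp_zmod_morphism mapcoefB. Qed.
HB.instance Definition _ := GRing.isZmodMorphism.Build
  {malg V[G]} {malg V[G]} (@mapcoef V G d) mapcoef_zmod_morphism.

Lemma mapcoefU (m : G) c : mapcoef d << c *g m >> = << d c *g m >>.
Proof. exact: sum_msuppU mapcoefB _ _. Qed.

Lemma mulmon_comm (e e' : G) (f : {malg V[G]}) :
  mulmon e (mulmon e' f) = mulmon e' (mulmon e f).
Proof.
move: f; apply: zmod_morphism_eq_monomials => [x y|x y|c k].
- by rewrite !raddfB.
- by rewrite !raddfB.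
- by rewrite !mulmonU addrCA.
Qed.

Lemma mapcoef_mulmon (e : G) (f : {malg V[G]}) :
  mapcoef d (mulmon e f) = mulmon e (mapcoef d f).
Proof.
move: f; apply: zmod_morphism_eq_monomials => [x y|x y|c k].
- by rewrite !raddfB.
- by rewrite !raddfB.
- by rewrite !(mulmonU, mapcoefU).
Qed.

HB.instance Definition _ := GRing.isZmodMorphism.Build
  V {malg V[G]} (@cstpol V G) (@raddfB _ _ (mkmalgU 0)).

End Operators.

(** * Substitution of an operator for the variable *)

Section Subst.
Variables (V : zmodType) (G : nmodType) (d : {additive V -> V}).

Section Morphism.
Variables (T : {additive {malg V[G]} -> {malg V[G]}}) (F : V -> {malg V[G]}).
Hypothesis FB : zmod_morphism F.

Let iterB n : zmod_morphism (fun c => iter n T (F c)).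
Proof. by move=> x y; rewrite FB raddfB. Qed.

Lemma subst_zmod_morphism : zmod_morphism (subst T F).
Proof. exact: sum_msupp_zmod_morphism iterB. Qed.

Lemma substD : {morph subst T F : f g / f + g}.
Proof.
pose S : {additive _ -> _} := HB.pack (subst T F)
  (GRing.isZmodMorphism.Build _ _ (subst T F) subst_zmod_morphism).
exact: (raddfD S).
Qed.

Lemma substN : {morph subst T F : f / - f}.
Proof.
pose S : {additive _ -> _} := HB.pack (subst T F)
  (GRing.isZmodMorphism.Build _ _ (subst T F) subst_zmod_morphism).
exact: (raddfN S).
Qed.

Lemma substMzl (s : int) : {morph subst T F : f / f *~ s}.
Proof.
pose S : {additive _ -> _} := HB.pack (subst T F)
  (GRing.isZmodMorphism.Build _ _ (subst T F) subst_zmod_morphism).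
exact: (raddfMz S).
Qed.

Lemma substU c n : subst T F << c *g n >> = iter n T (F c).
Proof. exact: sum_msuppU iterB _ _. Qed.

Lemma subst_cstpol c : subst T F (cstpol _ c) = F c.
Proof. exact: substU. Qed.

Lemma subst_mulmon1 f : subst T F (mulmon 1%N f) = T (subst T F f).
Proof.
move: f; apply: zmod_morphism_eq_monomials => [x y|x y|c k].
- by rewrite raddfB subst_zmod_morphism.
- by rewrite subst_zmod_morphism raddfB.
- by rewrite mulmonU !substU.
Qed.

Lemma subst_mapcoef (D : {additive {malg V[G]} -> {malg V[G]}}) f :
    (forall x, F (d x) = D (F x)) -> (forall g, T (D g) = D (T g)) ->
  subst T F (mapcoef d f) = D (subst T F f).
Proof.
move=> FD TD; move: f; apply: zmod_morphism_eq_monomials => [x y|x y|c k].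
- by rewrite raddfB subst_zmod_morphism.
- by rewrite subst_zmod_morphism raddfB.
- by rewrite mapcoefU !substU FD; elim: k => //= k ->.
Qed.

End Morphism.

Lemma eq_subst (T T' : {malg V[G]} -> {malg V[G]}) F F' f :
  T =1 T' -> (forall n, F f@_n = F' f@_n) -> subst T F f = subst T' F' f.
Proof. by move=> TT FF; apply: eq_bigr => n _; rewrite FF (eq_iter TT). Qed.

Lemma substBr (T : {additive {malg V[G]} -> {malg V[G]}}) F F' f :
  subst T (fun x => F x - F' x) f = subst T F f - subst T F' f.
Proof. by rewrite /subst -sumrB; apply: eq_bigr => n _; rewrite raddfB. Qed.

Lemma substMz (T : {additive {malg V[G]} -> {malg V[G]}}) F f (s : int) :
  subst T (fun x => F x *~ s) f = subst T F f *~ s.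
Proof. by rewrite /subst mulrz_suml; apply: eq_bigr => n _; rewrite raddfMz. Qed.

(** [H] turns each power of [T] into the same power of [T'], so only the coefficient map changes.
    With a substitution as [H], this composes two substitutions, which is how flips and changes of
    operators are computed. *)
Lemma subst_morph (G' : nmodType) (H : {malg V[G]} -> {malg V[G']}) T T' F f :
    zmod_morphism H -> (forall g, H (T g) = T' (H g)) ->
  H (subst T F f) = subst T' (H \o F) f.
Proof.
move=> HB HT; pose H' : {additive _ -> _} :=
  HB.pack H (GRing.isZmodMorphism.Build _ _ H HB).
rewrite -[H]/(H' : _ -> _) /subst raddf_sum; apply: eq_bigr => n _ /=.
by elim: n (F _) => //= n IHn x; rewrite HT IHn.
Qed.

End Subst.

(** * Balanced operators and flips of nested products *)

Section ConformalProduct.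
Variables (K : fieldType) (L : gradedDModule K).
Local Notation P2 := {malg L[(nat * nat)%type]}.

Definition del2 : P2 -> P2 := mapcoef (partial L).

HB.instance Definition _ :=
  GRing.isZmodMorphism.Build _ _ (@lam1 K L) (mulmon_zmod_morphism _).
HB.instance Definition _ :=
  GRing.isZmodMorphism.Build _ _ (@lam K L) (mulmon_zmod_morphism _).
HB.instance Definition _ :=
  GRing.isZmodMorphism.Build _ _ (@mu K L) (mulmon_zmod_morphism _).
HB.instance Definition _ :=
  GRing.isZmodMorphism.Build _ _ (@del1 K L) (mapcoef_zmod_morphism _).
HB.instance Definition _ :=
  GRing.isZmodMorphism.Build _ _ del2 (mapcoef_zmod_morphism _).

Lemma lam_mu (f : P2) : lam (mu f) = mu (lam f).
Proof. exact: mulmon_comm. Qed.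

Lemma lam_del2 (f : P2) : lam (del2 f) = del2 (lam f).
Proof. by rewrite /del2 /lam mapcoef_mulmon. Qed.

Lemma mu_del2 (f : P2) : mu (del2 f) = del2 (mu f).
Proof. by rewrite /del2 /mu mapcoef_mulmon. Qed.

(* The operators by which the three slots of a nested product a _A (b _B c)
   act: C = - A - B - partial belongs to the innermost argument c. *)
Definition balanced (A B C : P2 -> P2) :=
  [/\ forall f, A (B f) = B (A f),
      forall f, A (del2 f) = del2 (A f),
      forall f, B (del2 f) = del2 (B f)
    & forall f, C f = - A f - B f - del2 f].

Lemma balanced_swap A B C : balanced A B C -> balanced B A C.
Proof. by case=> AB Ad Bd CE; split=> // f; rewrite CE [- A f - _]addrC. Qed.

(** The relation [A + B + C + partial = 0] is symmetric in the three operators, and [C] inherits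
    commutation from [A], [B] and [partial]. *)
Lemma balanced_rot (A B C : {additive P2 -> P2}) :
  balanced A B C -> balanced C A B.
Proof.
case=> AB Ad Bd CE; split=> // f; rewrite !CE.
- by rewrite !(raddfB, raddfN) AB Ad.
- by rewrite !(raddfB, raddfN) Ad Bd.
- by rewrite !opprD !opprK addrAC [A f + _]addrC !addrK.
Qed.

(** For [A = lam] and [B = mu] this is the triple met when the outer product of [[b_{mu-lam} a] o_mu
    c] is flipped: [c] then acts with [- mu - partial], [b] with [mu - lam], and [a] is left with
    [lam]. *)
Lemma balanced_sub (A B C : {additive P2 -> P2}) :
  balanced A B C -> balanced ((\- B) \- del2) (B \- A) A.
Proof.
case=> AB Ad Bd _; split=> f /=.
- rewrite !(raddfB B) (raddfB del2) (raddfB A) (raddfN B) (raddfN A) AB Ad Bd.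
  by rewrite !opprD !opprK addrACA.
- by rewrite (raddfB del2) (raddfN del2) Bd.
- by rewrite (raddfB del2) Ad Bd.
- by rewrite !opprD !opprK addrAC addrK addrA subrr add0r.
Qed.

Section Product.
Variable (p : lproduct L).
Hypothesis Hp : conformal_product p.

Lemma conformal_productBl a a' b : p (a - a') b = p a b - p a' b.
Proof.
case: Hp => lin _ _ _ _; apply/malgP => n; rewrite mcoeffB.
(* The difference is put in the form [-1 *: a' + a], the shape to which linearity applies. *)
by rewrite -[a - a']addrC -scaleN1r lin scaleN1r addrC.
Qed.

Lemma conformal_productBr a b b' : p a (b - b') = p a b - p a b'.
Proof.
case: Hp => _ lin _ _ _; apply/malgP => n; rewrite mcoeffB.
by rewrite -[b - b']addrC -scaleN1r lin scaleN1r addrC.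
Qed.

Lemma subst_productl_zmod_morphism (T : {additive P2 -> P2}) b :
  zmod_morphism (fun a => subst T (@cstpol _ _) (p a b)).
Proof.
move=> a a'; rewrite conformal_productBl subst_zmod_morphism //.
exact: raddfB.
Qed.

Lemma subst_productr_zmod_morphism (T : {additive P2 -> P2}) a :
  zmod_morphism (fun b => subst T (@cstpol _ _) (p a b)).
Proof.
move=> b b'; rewrite conformal_productBr subst_zmod_morphism //.
exact: raddfB.
Qed.

Lemma subst_product_partialr (T : {additive P2 -> P2}) a b :
    (forall f, T (del2 f) = del2 (T f)) ->
  subst T (@cstpol _ _) (p a (partial L b)) =
    del2 (subst T (@cstpol _ _) (p a b)) + T (subst T (@cstpol _ _) (p a b)).
Proof.
move=> Td; case: Hp => _ _ _ _ ->.
have cstB : zmod_morphism (@cstpol L (nat * nat)%type) by exact: raddfB.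
rewrite substD //; congr (_ + _).
  by apply: subst_mapcoef => // x; rewrite [RHS]mapcoefU.
exact: subst_mulmon1.
Qed.

End Product.

Section Nested.
Variables (p q : lproduct L).
Hypotheses (Hp : conformal_product p) (Hq : conformal_product q).
Variables (T S : {additive P2 -> P2}).

Lemma nestrBl a a' b c :
  nestr p T q S (a - a') b c = nestr p T q S a b c - nestr p T q S a' b c.
Proof.
rewrite /nestr -substBr; apply: eq_subst => // n.
exact: subst_productl_zmod_morphism.
Qed.

Lemma nestrBm a b b' c :
  nestr p T q S a (b - b') c = nestr p T q S a b c - nestr p T q S a b' c.
Proof.
by rewrite /nestr conformal_productBl // subst_zmod_morphism //;
  apply: subst_productr_zmod_morphism.
Qed.

Lemma nestrBr a b c c' :
  nestr p T q S a b (c - c') = nestr p T q S a b c - nestr p T q S a b c'.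
Proof.
by rewrite /nestr conformal_productBr // subst_zmod_morphism //;
  apply: subst_productr_zmod_morphism.
Qed.

Lemma nestlBl a a' b c :
  nestl p T q S (a - a') b c = nestl p T q S a b c - nestl p T q S a' b c.
Proof.
by rewrite /nestl conformal_productBl // subst_zmod_morphism //;
  apply: subst_productl_zmod_morphism.
Qed.

Lemma nestlBm a b b' c :
  nestl p T q S a (b - b') c = nestl p T q S a b c - nestl p T q S a b' c.
Proof.
by rewrite /nestl conformal_productBr // subst_zmod_morphism //;
  apply: subst_productl_zmod_morphism.
Qed.

Lemma nestlBr a b c c' :
  nestl p T q S a b (c - c') = nestl p T q S a b c - nestl p T q S a b c'.
Proof.
rewrite /nestl -substBr; apply: eq_subst => // n.
exact: subst_productr_zmod_morphism.
Qed.

(** Flipping the inner product replaces its variable by [- partial - lambda]. By sesquilinearity of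
    the outer product, [partial] on an inner coefficient becomes [del2 + T], so the new operator is
    [- (del2 + T) - S], which is [U]. *)
Lemma nestr_flip (U : P2 -> P2) a b c (s : int) :
    balanced T S U -> q b c = flip q b c *~ s ->
  nestr p T q S a b c = nestr p T q U a c b *~ s.
Proof.
case=> TS Td Sd UE qE.
set F := fun x => subst T (@cstpol _ _) (p a x).
have FB : zmod_morphism F by apply: subst_productr_zmod_morphism.
rewrite /nestr qE (substMzl S FB) /flip; apply: (congr1 (fun f : P2 => f *~ s)).
rewrite (@subst_morph _ _ _ (subst S F) _ U).
- by apply: eq_subst => // n /=; rewrite subst_cstpol.
- exact: subst_zmod_morphism.
- move=> g; rewrite substD // !substN // UE subst_mulmon1 //.
  rewrite (@subst_mapcoef _ _ _ _ _ _ (del2 \+ T)) //=.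
  + by rewrite opprD -addrA addrC.
  + by move=> x; apply: subst_product_partialr.
  + by move=> f; rewrite raddfD /= Sd TS.
Qed.

(** Flipping the outer product brings a left-nested product to right-nested form. Here [partial]
    acts on the final coefficients, so [S] just becomes [- S - del2]. *)
Lemma nestl_flip (U : P2 -> P2) a b c (s : int) :
    (forall f, S (del2 f) = del2 (S f)) -> (forall f, U f = - S f - del2 f) ->
    (forall n, q (p a b)@_n c = flip q (p a b)@_n c *~ s) ->
  nestl p T q S a b c = nestr q U p T c a b *~ s.
Proof.
move=> Sd UE qE; rewrite /nestl /nestr -substMz; apply: eq_subst => // n.
have cstB : zmod_morphism (@cstpol L (nat * nat)%type) by exact: raddfB.
rewrite qE (substMzl S cstB) /flip; apply: (congr1 (fun f : P2 => f *~ s)).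
rewrite (@subst_morph _ _ _ (subst S (@cstpol _ _)) _ U).
- by apply: eq_subst => // m /=; rewrite subst_cstpol.
- exact: subst_zmod_morphism.
- move=> g; rewrite substD // !substN // UE subst_mulmon1 //.
  rewrite (@subst_mapcoef _ _ _ _ _ _ del2) //.
  + by rewrite addrC.
  + by move=> x; rewrite [RHS]mapcoefU.
Qed.

End Nested.

(** * Simultaneous substitution of operators for lambda and mu *)

Definition subst2 (A B : P2 -> P2) (f : P2) : P2 :=
  \sum_(m <- msupp f) iter m.1 A (iter m.2 B (cstpol _ f@_m)).

Section Transport.
Variables (A B : {additive P2 -> P2}).
Hypothesis AB : forall f, A (B f) = B (A f).

Let iterB (m : nat * nat) :
  zmod_morphism (fun c : L => iter m.1 A (iter m.2 B (cstpol _ c))).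
Proof. by move=> x y; rewrite !raddfB. Qed.

Lemma subst2_zmod_morphism : zmod_morphism (subst2 A B).
Proof. exact: sum_msupp_zmod_morphism iterB. Qed.

Lemma subst2D f g : subst2 A B (f + g) = subst2 A B f + subst2 A B g.
Proof.
pose H : {additive _ -> _} := HB.pack (subst2 A B)
  (GRing.isZmodMorphism.Build _ _ _ subst2_zmod_morphism).
exact: (raddfD H).
Qed.

Lemma subst2Mz f (s : int) : subst2 A B (f *~ s) = subst2 A B f *~ s.
Proof.
pose H : {additive _ -> _} := HB.pack (subst2 A B)
  (GRing.isZmodMorphism.Build _ _ _ subst2_zmod_morphism).
exact: (raddfMz H).
Qed.

Lemma subst2U (c : L) m :
  subst2 A B << c *g m >> = iter m.1 A (iter m.2 B (cstpol _ c)).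
Proof. exact: sum_msuppU iterB _ _. Qed.

Lemma subst2_lam f : subst2 A B (lam f) = A (subst2 A B f).
Proof.
move: f; apply: zmod_morphism_eq_monomials => [x y|x y|c k].
- by rewrite raddfB subst2_zmod_morphism.
- by rewrite subst2_zmod_morphism raddfB.
- by rewrite /lam mulmonU !subst2U.
Qed.

Lemma subst2_mu f : subst2 A B (mu f) = B (subst2 A B f).
Proof.
move: f; apply: zmod_morphism_eq_monomials => [x y|x y|c [m n]].
- by rewrite raddfB subst2_zmod_morphism.
- by rewrite subst2_zmod_morphism raddfB.
(* The powers of [A] stand outside those of [B] in [subst2], so the new factor [B] must be moved
   past them. *)
- by rewrite /mu mulmonU !subst2U /=; elim: m => //= m ->; rewrite AB.
Qed.

(** The axioms are identities in the formal variables; applying [subst2 A B] to both sides transfers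
    them to any commuting operators [A] and [B]. *)
Lemma subst2_nestr (p q : lproduct L) (T T' S S' : P2 -> P2) a b c :
    (forall f, subst2 A B (T f) = T' (subst2 A B f)) ->
    (forall f, subst2 A B (S f) = S' (subst2 A B f)) ->
  subst2 A B (nestr p T q S a b c) = nestr p T' q S' a b c.
Proof.
move=> TT SS; rewrite /nestr (subst_morph _ _ subst2_zmod_morphism SS).
apply: eq_subst => // n /=.
rewrite (subst_morph _ _ subst2_zmod_morphism TT).
by apply: eq_subst => // m /=; apply: subst2U.
Qed.

Lemma subst2_nestl (p q : lproduct L) a b c :
  subst2 A B (nestl p lam q (lam \+ mu) a b c) = nestl p A q (A \+ B) a b c.
Proof.
rewrite /nestl (subst_morph _ _ subst2_zmod_morphism subst2_lam).
apply: eq_subst => // n /=; rewrite (@subst_morph _ _ _ (subst2 A B) _ (A \+ B)).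
- by apply: eq_subst => // m /=; apply: subst2U.
- exact: subst2_zmod_morphism.
- by move=> g; rewrite /= subst2D subst2_lam subst2_mu.
Qed.

End Transport.
End ConformalProduct.

(** * Reduction to homogeneous arguments, and Koszul signs *)

Lemma eq0_homogeneous (K : fieldType) (L : gradedDModule K) (W : zmodType)
    (F : L -> L -> L -> W) :
    (forall b c, zmod_morphism (F^~ b ^~ c)) ->
    (forall a c, zmod_morphism (F a ^~ c)) ->
    (forall a b, zmod_morphism (F a b)) ->
    (forall i j k a b c, a \in gpart L i -> b \in gpart L j ->
      c \in gpart L k -> F a b c = 0) ->
  forall a b c, F a b c = 0.
Proof.
have ext (f : L -> W) : zmod_morphism f ->
    (forall i x, x \in gpart L i -> f x = 0) -> forall x, f x = 0.
  move=> fB f0 x; have [x0 [x1 [x0P x1P ->]]] := gpart_sum x.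
  pose g : {additive _ -> _} := HB.pack f (GRing.isZmodMorphism.Build _ _ f fB).
  have fD : {morph f : u v / u + v} by exact: (raddfD g).
  by rewrite fD (f0 0 _ x0P) (f0 1 _ x1P) addr0.
move=> Fa Fb Fc F0 a b c.
(* The arguments are split into even and odd components one at a time, the other two staying
   fixed. *)
apply: (ext (F^~ b ^~ c)) => // i x xi; apply: (ext (F x ^~ c)) => // j y yj.
by apply: ext => // k z zk; apply: F0 xi yj zk.
Qed.

Lemma ksignC i j : ksign i j = ksign j i.
Proof. by rewrite /ksign mulrC. Qed.

Lemma ksignDl i j k : ksign (i + j) k = ksign i k * ksign j k.
Proof. by case: i j k => [[|[|//]] ?] [[|[|//]] ?] [[|[|//]] ?]. Qed.

Lemma ksign_sqr i j : ksign i j * ksign i j = 1.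
Proof. by case: i j => [[|[|//]] ?] [[|[|//]] ?]. Qed.

(** * Vanishing of nested products under both Leibniz rules *)

Section PoissonTransposed.
Variables (K : fieldType) (L : gradedDModule K) (circ br : lproduct L).
Local Notation P2 := {malg L[(nat * nat)%type]}.
Hypothesis Hcirc : comm_assoc_conformal_superalgebra circ.
Hypothesis Hbr : lie_conformal_superalgebra br.

Let circ_prod : conformal_product circ. Proof. by case: Hcirc. Qed.
Let br_prod : conformal_product br. Proof. by case: Hbr. Qed.

Lemma product_gpart (p : lproduct L) i j a b n : conformal_product p ->
  a \in gpart L i -> b \in gpart L j -> (p a b)@_n \in gpart L (i + j).
Proof. by case=> _ _ gp _ _; apply: gp. Qed.

Section Balanced.
Variables (A B C : {additive P2 -> P2}) (i j k : 'Z_2) (a b c : L).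
Hypotheses (bal : balanced A B C).
Hypotheses (ai : a \in gpart L i) (bj : b \in gpart L j) (ck : c \in gpart L k).

Lemma nestr_circ_br_skew :
  nestr circ A br B a b c = - nestr circ A br C a c b *~ ksign j k.
Proof.
(* The minus sign of skew symmetry is absorbed into the integer factor, so that the general flip
   applies with [s = - ksign j k]. *)
case: Hbr => _ skew _; rewrite mulNrz -mulrNz.
by apply: (nestr_flip circ_prod _ bal); rewrite mulrNz; apply: skew.
Qed.

(** The coefficients of [a o b] have parity [i + j], and flipping the outer bracket turns [A + B]
    into [- A - B - partial], which is [C]. *)
Lemma nestl_circ_br :
  nestl circ A br (A \+ B) a b c = - nestr br C circ A c a b *~ ksign (i + j) k.
Proof.
case: Hbr => _ skew _; case: bal => AB Ad Bd CE; rewrite mulNrz -mulrNz.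
apply: (nestl_flip A (S := A \+ B)) => [f|f|n] /=.
- by rewrite raddfD /= Ad Bd.
- by rewrite CE opprD.
- by rewrite mulrNz; apply: skew => //; apply: product_gpart.
Qed.

Lemma nestl_br_circ :
  nestl br A circ (A \+ B) a b c = nestr circ C br A c a b *~ ksign (i + j) k.
Proof.
case: Hcirc => _ comm _; case: bal => AB Ad Bd CE.
apply: (nestl_flip A (S := A \+ B)) => [f|f|n] /=.
- by rewrite raddfD /= Ad Bd.
- by rewrite CE opprD.
- by apply: comm => //; apply: product_gpart.
Qed.

(** Substituting [A] and [B] for lambda and mu in the axiom and flipping its one left-nested term
    leaves only right-nested products, each slot keeping its own operator. *)
Lemma leibniz_nestr : conformal_leibniz circ br ->
  nestr br A circ B a b c =
    nestr circ C br A c a b *~ ksign (i + j) k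
    + nestr circ B br A b a c *~ ksign i j.
Proof.
move=> leib; case: (bal) => AB _ _ _.
have phi_lam := subst2_lam A B; have phi_mu := subst2_mu AB.
rewrite -(subst2_nestr _ _ _ _ _ phi_lam phi_mu) (leib _ _ _ _ _ ai bj).
rewrite subst2D subst2Mz (subst2_nestl AB).
by rewrite nestl_br_circ (subst2_nestr _ _ _ _ _ phi_mu phi_lam).
Qed.

Lemma transposed_leibniz_nestr : conformal_transposed_leibniz circ br ->
  nestr circ A br B a b c *+ 2 =
    - nestr br C circ A c a b *~ ksign (i + j) k
    + nestr br B circ A b a c *~ ksign i j.
Proof.
move=> leib; case: (bal) => AB _ _ _.
have phi_lam := subst2_lam A B; have phi_mu := subst2_mu AB.
rewrite -(subst2_nestr _ _ _ _ _ phi_lam phi_mu) mulr2n -subst2D.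
rewrite -mulr2n (leib _ _ _ _ _ ai bj).
rewrite subst2D subst2Mz (subst2_nestl AB).
by rewrite nestl_circ_br (subst2_nestr _ _ _ _ _ phi_mu phi_lam).
Qed.

End Balanced.

Hypothesis leib : conformal_leibniz circ br.
Hypothesis tleib : conformal_transposed_leibniz circ br.

(* In the transposed Leibniz rule for (c, a, b), both brackets of products are
   expanded by the Leibniz rule; the terms in c o [a b] cancel. *)
Lemma nestr_circ_br_sym (A B C : {additive P2 -> P2}) i j k a b c :
    balanced A B C -> a \in gpart L i -> b \in gpart L j -> c \in gpart L k ->
  nestr circ A br B a b c = nestr circ B br A b a c *~ ksign i j.
Proof.
move=> bal ai bj ck; have balC := balanced_rot bal.
have balB := balanced_rot balC; have balAC := balanced_swap balC.
have := transposed_leibniz_nestr balC ck ai bj tleib.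
rewrite (leibniz_nestr balB bj ck ai leib) (leibniz_nestr balAC ai ck bj leib).
rewrite (nestr_circ_br_skew c (balanced_swap balB) bj ai).
set x := nestr circ C br A c a b; set y := nestr circ A br B a b c.
set z := nestr circ B br A b a c.
rewrite !mulNrz !mulrzDl !mulNrz opprD opprK addrC addrA.
rewrite -!mulrzA !ksignDl [ksign j i]ksignC [ksign k i]ksignC [ksign k j]ksignC.
rewrite (mulrA (ksign j k)) [ksign j k * ksign i j]mulrC mulrACA !ksign_sqr.
rewrite mul1r ksign_sqr mul1r mulr1z mulr2n [_ + x - _]addrAC.
move=> /(canLR (addrK _)); rewrite addrK => /(canLR (addrK _)).
rewrite subrr => /esym/eqP; rewrite subr_eq0 -mulrA mulrzA.
rewrite [ksign j k * _]mulrC => /eqP zy.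
(* After cancellation [y] carries the sign [ksign i k * ksign j k]; inserting squares of both
   factors, each equal to 1, makes that product appear. *)
rewrite -[y](mulr1z) -(ksign_sqr i k) -[X in y *~ X]mulr1 -(ksign_sqr j k).
by rewrite mulrACA mulrzA -zy -mulrzA mulrACA !ksign_sqr mulr1 mulr1z.
Qed.

Hypothesis char2 : 2%:R != 0 :> K.

Lemma malg_mulr2n_eq0 (G : choiceType) (f : {malg L[G]}) : f *+ 2 = 0 -> f = 0.
Proof.
move=> f2; apply/malgP => m; have /eqP := congr1 (mcoeff m) f2.
by rewrite mcoeffMn mcoeff0 -scaler_nat scaler_eq0 (negPf char2) => /eqP.
Qed.

Lemma nestr_circ_br_eq0 (A B C : {additive P2 -> P2}) i j k a b c :
    balanced A B C -> a \in gpart L i -> b \in gpart L j -> c \in gpart L k ->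
  nestr circ A br B a b c = 0.
Proof.
move=> bal ai bj ck; apply: malg_mulr2n_eq0; rewrite mulr2n.
have balC := balanced_rot bal; have balB := balanced_rot balC.
apply/eqP; rewrite addr_eq0; apply/eqP.
(* Skew symmetry and the symmetry in the first two slots alternate through
   [abc, acb, cab, cba, bca, bac, abc]. The three skew steps give the sign -1, and each Koszul sign
   occurs twice. *)
rewrite {1}(nestr_circ_br_skew a bal bj ck).
rewrite (nestr_circ_br_sym (balanced_swap balC) ai ck bj).
rewrite (nestr_circ_br_skew c balC ai bj).
rewrite (nestr_circ_br_sym (balanced_swap balB) ck bj ai).
rewrite (nestr_circ_br_skew b balB ck ai).
rewrite (nestr_circ_br_sym (balanced_swap bal) bj ai ck).
rewrite !mulNrz !opprK -!mulrzA.
rewrite [ksign j i]ksignC [ksign k i]ksignC [ksign k j]ksignC.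
rewrite (mulrA (ksign i k)) mulrA mulrACA ksign_sqr.
by rewrite mul1r mulrACA !ksign_sqr mulr1z.
Qed.

Lemma nestr_br_circ_eq0 (A B C : {additive P2 -> P2}) i j k a b c :
    balanced A B C -> a \in gpart L i -> b \in gpart L j -> c \in gpart L k ->
  nestr br A circ B a b c = 0.
Proof.
move=> bal ai bj ck; have balC := balanced_rot bal.
rewrite (leibniz_nestr bal ai bj ck leib).
rewrite (nestr_circ_br_eq0 balC ck ai bj).
by rewrite (nestr_circ_br_eq0 (balanced_swap bal) bj ai ck) !mul0rz addr0.
Qed.

End PoissonTransposed.

(** * From both Leibniz rules to the three vanishing products *)

Section Equivalence.
Variables (K : fieldType) (L : gradedDModule K) (circ br : lproduct L).
Local Notation P2 := {malg L[(nat * nat)%type]}.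
Hypothesis char2 : 2%:R != 0 :> K.
Hypothesis Hcirc : comm_assoc_conformal_superalgebra circ.
Hypothesis Hbr : lie_conformal_superalgebra br.

Let circ_prod : conformal_product circ. Proof. by case: Hcirc. Qed.
Let br_prod : conformal_product br. Proof. by case: Hbr. Qed.

Let nu : {additive P2 -> P2} := (\- lam) \- mu \- @del2 K L.

Let balanced_nu : balanced lam mu nu.
Proof. by split; [exact: lam_mu|exact: lam_del2|exact: mu_del2|]. Qed.

Lemma poisson_transposed_products_eq0 :
    conformal_leibniz circ br -> conformal_transposed_leibniz circ br ->
  forall a b c : L,
    [/\ nestr circ lam br mu a b c = 0,
        nestl br (mu \- lam) circ mu b a c = 0
      & nestl circ lam br (lam \+ mu) a b c = 0].
Proof.
move=> leib tleib a b c; split.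
- move: a b c; apply: eq0_homogeneous.
  + by move=> b c a a'; apply: nestrBl.
  + by move=> a c b b'; apply: nestrBm.
  + by move=> a b c c'; apply: nestrBr.
  + move=> i j k a b c.
    exact: (nestr_circ_br_eq0 Hcirc Hbr leib tleib char2 balanced_nu).
- move: b a c; apply: eq0_homogeneous.
  + by move=> b c a a'; apply: nestlBl.
  + by move=> a c b b'; apply: nestlBm.
  + by move=> a b c c'; apply: nestlBr.
  + move=> i j k a b c ai bj ck; case: (Hcirc) => _ comm _.
    (* [U] is the operator of [c] once the outer product, taken at [mu], is flipped. *)
    pose U : {additive P2 -> P2} := (\- mu) \- @del2 K L.
    rewrite (@nestl_flip _ _ _ _ (mu \- lam) mu U _ _ _ (ksign (i + j) k)).
    * have bal : balanced U (mu \- lam) lam := balanced_sub balanced_nu.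
      rewrite (nestr_circ_br_eq0 Hcirc Hbr leib tleib char2 bal ck ai bj).
      exact: mul0rz.
    * exact: mu_del2.
    * by [].
    * by move=> n; apply: comm => //; apply: product_gpart.
- move: a b c; apply: eq0_homogeneous.
  + by move=> b c a a'; apply: nestlBl.
  + by move=> a c b b'; apply: nestlBm.
  + by move=> a b c c'; apply: nestlBr.
  + move=> i j k a b c ai bj ck; rewrite (nestl_circ_br Hcirc Hbr balanced_nu ai bj ck).
    have balC := balanced_rot balanced_nu.
    rewrite (nestr_br_circ_eq0 Hcirc Hbr leib tleib char2 balC ck ai bj).
    by rewrite oppr0 mul0rz.
Qed.

(** * From the vanishing products back to both Leibniz rules *)

Section Converse.
Hypothesis products0 : forall a b c : L,
  [/\ nestr circ lam br mu a b c = 0,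
      nestl br (mu \- lam) circ mu b a c = 0
    & nestl circ lam br (lam \+ mu) a b c = 0].
Variables A B C : {additive P2 -> P2}.
Hypothesis bal : balanced A B C.

Let subst20 : subst2 A B 0 = 0.
Proof. by rewrite /subst2 msupp0 big_seq_fset0. Qed.

Lemma nestr_circ_br_products0 a b c : nestr circ A br B a b c = 0.
Proof.
case: bal => AB _ _ _.
rewrite -(subst2_nestr _ _ _ _ _ (subst2_lam A B) (subst2_mu AB)).
by case: (products0 a b c) => ->.
Qed.

Lemma nestr_br_circ_products0 a b c : nestr br C circ A c a b = 0.
Proof.
move: c a b; apply: eq0_homogeneous.
- by move=> b c a a'; apply: nestrBl.
- by move=> a c b b'; apply: nestrBm.
- by move=> a b c c'; apply: nestrBr.
move=> k i j c a b ck ai bj.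
have := nestl_circ_br Hcirc Hbr bal ai bj ck; case: (bal) => AB _ _ _.
rewrite -(subst2_nestl AB); have [_ _ ->] := products0 a b c.
(* The Koszul sign is its own inverse, so multiplying by it once more removes it. *)
move=> /(congr1 (fun f : P2 => f *~ ksign (i + j) k)).
rewrite subst20 mul0rz -mulrzA ksign_sqr mulr1z => /esym/eqP.
by rewrite oppr_eq0 => /eqP.
Qed.

End Converse.

Lemma products_eq0_poisson_transposed :
    (forall a b c : L,
      [/\ nestr circ lam br mu a b c = 0,
          nestl br (mu \- lam) circ mu b a c = 0
        & nestl circ lam br (lam \+ mu) a b c = 0]) ->
  conformal_leibniz circ br /\ conformal_transposed_leibniz circ br.
Proof.
move=> products0; have balC := balanced_rot balanced_nu.
have balB := balanced_rot balC.
have T0 := nestr_circ_br_products0 products0.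
have U0 := nestr_br_circ_products0 products0.
split=> i j a b c ai bj.
  rewrite (U0 _ _ _ balB) (T0 _ _ _ (balanced_swap balanced_nu)) mul0rz addr0.
  (* The Leibniz rule leaves [c] arbitrary, but flipping the remaining left-nested term needs a
     parity for [c]; trilinearity bridges the gap. *)
  apply: esym; move: (a) (b) (c); apply: eq0_homogeneous.
  - by move=> y z x x'; apply: nestlBl.
  - by move=> x z y y'; apply: nestlBm.
  - by move=> x y z z'; apply: nestlBr.
  move=> i' j' k x y z xi yj zk.
  by rewrite (nestl_br_circ Hcirc Hbr balanced_nu xi yj zk) (T0 _ _ _ balC) mul0rz.
rewrite (T0 _ _ _ balanced_nu) (U0 _ _ _ (balanced_swap balC)) mul0rz addr0.
by have [_ _ ->] := products0 a b c; rewrite mul0rn.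
Qed.

End Equivalence.

Theorem proposition3p9 (R : realType) (L : gradedDModule R[i])
    (circ br : L -> L -> {malg L[nat]})
    (Hcirc : comm_assoc_conformal_superalgebra circ)
    (Hbr : lie_conformal_superalgebra br) :
  (poisson_conformal_superalgebra circ br /\
   transposed_poisson_conformal_superalgebra circ br)
  <->
  (forall a b c : L,
     [/\ nestr circ lam br mu a b c = 0,
         nestl br (mu \- lam) circ mu b a c = 0
       & nestl circ lam br (lam \+ mu) a b c = 0]).
Proof.
split=> [[[_ _ leib] [_ _ tleib]]|products0].
  by apply: poisson_transposed_products_eq0; rewrite ?Num.Theory.pnatr_eq0.
have [leib tleib] := products_eq0_poisson_transposed Hcirc Hbr products0.
by split; split.
Qed.
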